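(* Consider the $T$-stage repeated Bayesian game $\Gamma_T(p,q)$ (setting below). Then $$V_T(p,q)=\max \sum_{l\in L} q^l u_{l,0}$$ where the maximum is over $x\in X_T(p)$, real numbers $u_{l,0}$ ($l\in L$), and real $|A|\times|B|$ matrices $u_{l,h^A,h^B}$ for $l\in L$, $s=1,\dots,T-1$, $h^A\in A^{s-1}$, $h^B\in B^{s-1}$ (with the convention $u_{l,h^A,h^B}=0$ for $h^A\in A^{T-1},h^B\in B^{T-1}$), subject to $$\sum_{k\in K}(M^{kl})^T x_{k,\emptyset,\emptyset}+(u_{l,\emptyset,\emptyset})^T\mathbf 1\ \ge\ u_{l,0}\mathbf 1\quad \forall l\in L,$$ $$\sum_{k\in K}(M^{kl})^T x_{k,(h^A,a),(h^B,b)}+(u_{l,(h^A,a),(h^B,b)})^T\mathbf 1\ \ge\ u^{a,b}_{l,h^A,h^B}\mathbf 1$$ for all $s=1,\dots,T-1$, $l\in L$, $h^A\in A^{s-1}$, $h^B\in B^{s-1}$, $a\in A$, $b\in B$. Moreover, if $x^*$ is the $x$-part of an optimal solution, then the behavior strategy $\sigma^*$ defined by $\sigma_t^{a*}(k,h^A,h^B)=x^{a*}_{k,h^A,h^B}/x^{a'*}_{k,h'^A,h'^B}$, where $h^A=(h'^A,a')$, $h^B=(h'^B,b')$ (and the denominator is $p^k$ when $t=1$), is a security strategy of player 1 in $\Gamma_T(p,q)$. Dually, $$V_T(p,q)=\min \sum_{k\in K} p^k w_{k,0}$$ over $y\in Y_T(q)$, reals $w_{k,0}$ ($k\in K$), and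 real $|A|\times|B|$ matrices $w_{k,h^A,h^B}$ for $k\in K$, $s=1,\dots,T-1$, $h^A\in A^{s-1}$, $h^B\in B^{s-1}$ (with $w_{k,h^A,h^B}=0$ for histories of length $T-1$), subject to $$\sum_{l\in L}M^{kl}y_{l,\emptyset,\emptyset}+w_{k,\emptyset,\emptyset}\mathbf 1\le w_{k,0}\mathbf 1\quad\forall k\in K,$$ $$\sum_{l\in L}M^{kl}y_{l,(h^A,a),(h^B,b)}+w_{k,(h^A,a),(h^B,b)}\mathbf 1\le w^{a,b}_{k,h^A,h^B}\mathbf 1$$ for all $s=1,\dots,T-1$, $k\in K$, $h^A\in A^{s-1}$, $h^B\in B^{s-1}$, $a\in A$, $b\in B$; and if $y^*$ is the $y$-part of an optimal solution, the behavior strategy $\tau^*$ with $\tau_t^{b*}(l,h^A,h^B)=y^{b*}_{l,h^A,h^B}/y^{b'*}_{l,h'^A,h'^B}$ (where $h^A=(h'^A,a')$, $h^B=(h'^B,b')$, denominator $q^l$ when $t=1$) is a security strategy of player 2 in $\Gamma_T(p,q)$.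
   Context: A two-player zero-sum repeated Bayesian game is given by nonempty finite type sets $K$ (player 1) and $L$ (player 2), nonempty finite action sets $A$, $B$, a payoff function $M:K\times L\times A\times B\to\mathbb R$ (write $M^{kl}$ for the $|A|\times|B|$ matrix with entries $M^{kl}_{a,b}=M(k,l,a,b)$), and $p\in\Delta(K)$, $q\in\Delta(L)$ with all entries positive ($\Delta(S)$ = probability distributions on $S$, viewed as vectors; $\mathbf 1$ = all-ones vector). Types $k\sim p$, $l\sim q$ are drawn independently; player 1 privately learns $k$, player 2 privately learns $l$. At each stage $t$ both simultaneously choose $a_t\in A$, $b_t\in B$, which are publicly announced; $h_t^A=(a_1,\dots,a_{t-1})\in A^{t-1}$, $h_t^B=(b_1,\dots,b_{t-1})\in B^{t-1}$ (empty, written $\emptyset$, for $t=1$). A behavior strategy of player 1 is $\sigma=(\sigma_t)$ with $\sigma_t:K\times A^{t-1}\times B^{t-1}\to\Delta(A)$ ($\sigma_t^a$ = probability of $a$); of player 2, $\tau_t:L\times A^{t-1}\times B^{t-1}\to\Delta(B)$. In the $T$-stage game $\Gamma_T(p,q)$ the payoff to player 1 (maximizer; player 2 minimizes) is $\gamma_T(p,q,\sigma,\tau)=\mathbb E_{p,q,\sigma,\tau}[\sum_{t=1}^T M(k,l,a_t,b_t)]$; its value is $V_T(p,q)=\max_\sigma\min_\tau\gamma_T=\min_\tau\max_\sigma\gamma_T$. A security strategy of player 1 (resp. 2) is one attaining $\max_\sigma\min_\tau\gamma_T$ (resp. $\min_\tau\max_\sigma\gamma_T$). Realization plans: $X_T(p)$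 is the set of families $x=(x_{k,h^A,h^B})$, $k\in K$, $t=1,\dots,T$, $h^A\in A^{t-1}$, $h^B\in B^{t-1}$, with $x_{k,h^A,h^B}\in\mathbb R^{|A|}$ (entries $x^a_{k,h^A,h^B}$), such that $x\ge 0$, $\mathbf 1^Tx_{k,\emptyset,\emptyset}=p^k$ and $\mathbf 1^Tx_{k,(h^A,a),(h^B,b)}=x^a_{k,h^A,h^B}$ for all $t\le T-1$, $h^A\in A^{t-1},h^B\in B^{t-1}$, $a\in A$, $b\in B$ ($(h,a)$ = concatenation). The realization plan of $\sigma$ is $x^{a_t}_{k,h_t^A,h_t^B}=p^k\prod_{s=1}^t\sigma_s^{a_s}(k,h_s^A,h_s^B)$, with $h_s^A,h_s^B$ the prefixes of $h_t^A,h_t^B$. $Y_T(q)$ is defined symmetrically with $L$, $B$, $q$, vectors $y_{l,h^A,h^B}\in\mathbb R^{|B|}$ and constraints $\mathbf 1^Ty_{l,\emptyset,\emptyset}=q^l$, $\mathbf 1^Ty_{l,(h^A,a),(h^B,b)}=y^b_{l,h^A,h^B}$, $y\ge0$. *)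

(* Defs.v *)
From mathcomp Require Import all_boot all_order all_algebra.
From mathcomp Require Import reals.
Set Implicit Arguments. Unset Strict Implicit. Unset Printing Implicit Defensive.
Import Order.TTheory GRing.Theory Num.Theory.
Local Open Scope ring_scope.

(* Histories: h^A : seq A, h^B : seq B.  The pair (h^A,h^B) is a history of
   stage t (1 <= t <= T) iff size h^A = size h^B = t-1, i.e.
   size h^A = size h^B < T.  Concatenation (h,a) is [rcons h a].
   A behavior strategy of player 1 is a map sigma : K -> seq A -> seq B -> A -> R
   (sigma k hA hB a = sigma_t^a(k,hA,hB), t = size hA + 1), required to be a
   probability vector at every history of stages 1..T (its values elsewhere
   are irrelevant).  Likewise for player 2. *)

Section Game.
Variables (R : realType) (K L A B : finType).
Variable M : K -> L -> A -> B -> R.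
Variables (p : K -> R) (q : L -> R) (T : nat).

Definition is_hist (hA : seq A) (hB : seq B) : bool :=
  (size hA == size hB) && (size hA < T)%N.

Definition is_distA (d : A -> R) : Prop :=
  (forall a, 0 <= d a) /\ \sum_(a : A) d a = 1.
Definition is_distB (d : B -> R) : Prop :=
  (forall b, 0 <= d b) /\ \sum_(b : B) d b = 1.

Definition strategy1 (sigma : K -> seq A -> seq B -> A -> R) : Prop :=
  forall k hA hB, is_hist hA hB -> is_distA (sigma k hA hB).
Definition strategy2 (tau : L -> seq A -> seq B -> B -> R) : Prop :=
  forall l hA hB, is_hist hA hB -> is_distB (tau l hA hB).

Definition play_prob (sigma : K -> seq A -> seq B -> A -> R)
  (tau : L -> seq A -> seq B -> B -> R) (k : K) (l : L)
  (hA : T.-tuple A) (hB : T.-tuple B) : R :=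
  p k * q l *
  \prod_(s < T) (sigma k (take s hA) (take s hB) (tnth hA s)
                 * tau l (take s hA) (take s hB) (tnth hB s)).

Definition gammaT (sigma : K -> seq A -> seq B -> A -> R)
  (tau : L -> seq A -> seq B -> B -> R) : R :=
  \sum_(k : K) \sum_(l : L) \sum_(hA : T.-tuple A) \sum_(hB : T.-tuple B)
    play_prob sigma tau k l hA hB * \sum_(s < T) M k l (tnth hA s) (tnth hB s).

Definition is_value (v : R) : Prop :=
  (exists sigma, strategy1 sigma /\
     forall tau, strategy2 tau -> v <= gammaT sigma tau) /\
  (exists tau, strategy2 tau /\
     forall sigma, strategy1 sigma -> gammaT sigma tau <= v).

Definition security1 (v : R) (sigma : K -> seq A -> seq B -> A -> R) : Prop :=
  strategy1 sigma /\ forall tau, strategy2 tau -> v <= gammaT sigma tau.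
Definition security2 (v : R) (tau : L -> seq A -> seq B -> B -> R) : Prop :=
  strategy2 tau /\ forall sigma, strategy1 sigma -> gammaT sigma tau <= v.

Definition realX (x : K -> seq A -> seq B -> A -> R) : Prop :=
  (forall k hA hB a, is_hist hA hB -> 0 <= x k hA hB a) /\
  (forall k, \sum_(a : A) x k [::] [::] a = p k) /\
  (forall k hA hB a b, is_hist hA hB -> ((size hA).+1 < T)%N ->
     \sum_(a' : A) x k (rcons hA a) (rcons hB b) a' = x k hA hB a).

Definition realY (y : L -> seq A -> seq B -> B -> R) : Prop :=
  (forall l hA hB b, is_hist hA hB -> 0 <= y l hA hB b) /\
  (forall l, \sum_(b : B) y l [::] [::] b = q l) /\
  (forall l hA hB a b, is_hist hA hB -> ((size hA).+1 < T)%N ->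
     \sum_(b' : B) y l (rcons hA a) (rcons hB b) b' = y l hA hB b).

Definition ucut {I : Type} (u : I -> seq A -> seq B -> A -> B -> R)
  (i : I) (hA : seq A) (hB : seq B) (a : A) (b : B) : R :=
  if ((size hA).+1 < T)%N then u i hA hB a b else 0.

Definition primal_feas (x : K -> seq A -> seq B -> A -> R) (u0 : L -> R)
  (u : L -> seq A -> seq B -> A -> B -> R) : Prop :=
  realX x /\
  (forall l (b0 : B),
     \sum_(k : K) \sum_(a0 : A) M k l a0 b0 * x k [::] [::] a0
     + \sum_(a0 : A) ucut u l [::] [::] a0 b0 >= u0 l) /\
  (forall l hA hB a b (b0 : B), is_hist hA hB -> ((size hA).+1 < T)%N ->
     \sum_(k : K) \sum_(a0 : A) M k l a0 b0 * x k (rcons hA a) (rcons hB b) a0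
     + \sum_(a0 : A) ucut u l (rcons hA a) (rcons hB b) a0 b0
     >= ucut u l hA hB a b).

Definition primal_obj (u0 : L -> R) : R := \sum_(l : L) q l * u0 l.

Definition primal_opt x u0 u : Prop :=
  primal_feas x u0 u /\
  forall x' u0' u', primal_feas x' u0' u' -> primal_obj u0' <= primal_obj u0.

Definition dual_feas (y : L -> seq A -> seq B -> B -> R) (w0 : K -> R)
  (w : K -> seq A -> seq B -> A -> B -> R) : Prop :=
  realY y /\
  (forall k (a0 : A),
     \sum_(l : L) \sum_(b0 : B) M k l a0 b0 * y l [::] [::] b0
     + \sum_(b0 : B) ucut w k [::] [::] a0 b0 <= w0 k) /\
  (forall k hA hB a b (a0 : A), is_hist hA hB -> ((size hA).+1 < T)%N ->
     \sum_(l : L) \sum_(b0 : B) M k l a0 b0 * y l (rcons hA a) (rcons hB b) b0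
     + \sum_(b0 : B) ucut w k (rcons hA a) (rcons hB b) a0 b0
     <= ucut w k hA hB a b).

Definition dual_obj (w0 : K -> R) : R := \sum_(k : K) p k * w0 k.

Definition dual_opt y w0 w : Prop :=
  dual_feas y w0 w /\
  forall y' w0' w', dual_feas y' w0' w' -> dual_obj w0 <= dual_obj w0'.

Definition induced1 (x : K -> seq A -> seq B -> A -> R)
  (sigma : K -> seq A -> seq B -> A -> R) : Prop :=
  (forall k a, sigma k [::] [::] a = x k [::] [::] a / p k) /\
  (forall k hA hB a' b', is_hist hA hB -> ((size hA).+1 < T)%N ->
     x k hA hB a' != 0 ->
     forall a, sigma k (rcons hA a') (rcons hB b') a
               = x k (rcons hA a') (rcons hB b') a / x k hA hB a').

Definition induced2 (y : L -> seq A -> seq B -> B -> R)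
  (tau : L -> seq A -> seq B -> B -> R) : Prop :=
  (forall l b, tau l [::] [::] b = y l [::] [::] b / q l) /\
  (forall l hA hB a' b', is_hist hA hB -> ((size hA).+1 < T)%N ->
     y l hA hB b' != 0 ->
     forall b, tau l (rcons hA a') (rcons hB b') b
               = y l (rcons hA a') (rcons hB b') b / y l hA hB b').

End Game.

(* Main.v *)
Require Import Defs.
From mathcomp Require Import all_boot all_order all_algebra.
From mathcomp Require Import boolp reals ring lra.
Set Implicit Arguments. Unset Strict Implicit. Unset Printing Implicit Defensive.
Import Order.TTheory GRing.Theory Num.Theory.
Local Open Scope ring_scope.

(** The two linear programs are dual to each other: telescoping the constraints
    of one along a realization plan of the other gives weak duality, with the
    expected payoff of the two plans in between.  Equality is reached without
    LP theory: the finite matrix game on pure strategies has optimal mixed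
    strategies, whose realization plans [x], [y] are mixtures of the pure ones;
    backward induction against [x] (resp. [y]) yields multipliers whose
    objective is the payoff against a greedy pure best reply, hence at least
    (resp. at most) the value of the matrix game.  The dual half is the primal
    half for the game with the players exchanged and payoff [-M]. *)

(** * Minimax theorem for finite matrix games, from Farkas' lemma *)

(** Constraints are functionals on a fixed module, so that the induction on their number can compose
    them with a projection without leaving [V]. *)
Lemma farkas (R : realFieldType) (V : lmodType R) (J : eqType) (r : seq J)
    (a : J -> V -> R) (b : V -> R) :
  uniq r -> (forall j, scalar (a j)) -> scalar b ->
  (forall x, (forall j, j \in r -> a j x <= 0) -> b x <= 0) ->
  exists c : J -> R, (forall j, 0 <= c j) /\
    forall x, b x = \sum_(j <- r) c j * a j x.
Proof.
elim: r a b => [|j0 r IH] a b /=.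
  move=> _ _ lb hb; exists (fun=> 0); split=> // x; rewrite big_nil.
  have b0 : b 0 = 0 by have := lb 1 0 0; rewrite scaler0 addr0 mul1r; lra.
  have h1 : b x <= 0 by apply: hb.
  have h2 : b (- x) <= 0 by apply: hb.
  by have := lb (-1) x 0; rewrite scaleN1r addr0 b0; lra.
case/andP=> j0r ur la lb hb.
suff [c [e [c0 e0 cE]]] : exists (c : J -> R) e, [/\ forall j, 0 <= c j, 0 <= e &
    forall x, b x = e * a j0 x + \sum_(j <- r) c j * a j x].
  exists (fun j => if j == j0 then e else c j); split=> [j|x]; first by case: ifP.
  rewrite big_cons eqxx cE; congr (_ + _); apply: eq_big_seq => j jr.
  by case: eqP jr j0r => // ->->.
(* If the remaining constraints do not imply [b <= 0], a counterexample [x0] has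
   [0 < a j0 x0]; apply the induction hypothesis after projecting along [x0]
   onto the kernel of [a j0]. *)
have [H|/existsNP[x0 /not_implyP[x0r /negP]]] :=
    pselect (forall x, (forall j, j \in r -> a j x <= 0) -> b x <= 0).
  have [c [c0 cE]] := IH a b ur la lb H.
  by exists c, 0; split=> // x; rewrite mul0r add0r.
rewrite -ltNge => bx0.
have ax0 : 0 < a j0 x0.
  rewrite ltNge; apply/negP => ax0; move: bx0; rewrite ltNge => /negP; apply.
  by apply: hb => j; rewrite inE => /orP[/eqP->//|/x0r].
set t := (a j0 x0)^-1.
pose pr x := (- (a j0 x * t)) *: x0 + x.
have lpr f : scalar f -> scalar (f \o pr).
  move=> lf k u v; rewrite /= /pr !lf la.
  ring.
case: (IH (fun j => a j \o pr) (b \o pr) ur).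
- by move=> j; apply: lpr.
- exact: lpr.
- move=> x hx /=; apply: hb => j; rewrite inE => /orP[/eqP->|]; last exact: hx.
  by rewrite /pr la; rewrite /t mulNr -mulrA mulVf ?gt_eqF // mulr1 addNr.
move=> c [c0 cE].
(* The coefficient of [a j0] is what the identity for the projected functionals leaves over along
   [x0]. It is nonnegative because [b x0] is positive while [a j x0] is nonpositive for [j] in
   [r]. *)
exists c, (t * (b x0 - \sum_(j <- r) c j * a j x0)); split=> //.
  apply: mulr_ge0; first by rewrite invr_ge0 ltW.
  rewrite subr_ge0; apply: le_trans (ltW bx0); rewrite -oppr_ge0 -sumrN big_seq.
  by apply: sumr_ge0 => j jr; rewrite -mulrN mulr_ge0 // oppr_ge0 x0r.
move=> x; have := cE x; rewrite /= /pr lb.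
under eq_bigr => j _ do rewrite la mulrDr mulrCA.
rewrite big_split -mulr_sumr /= => e.
by move: e; lra.
Qed.

(** Up to normalization, [z] is an optimal strategy of the symmetric game [S]. Without it, the sign
    constraints ([inl]) and the row constraints ([inr]) would force the total mass to be
    nonpositive, and Farkas' lemma would express that mass through them. *)
Lemma skew_kernel (R : realFieldType) (I : finType) (S : I -> I -> R) (i0 : I) :
  (forall i j, S i j = - S j i) ->
  exists z : I -> R, [/\ forall i, 0 <= z i, 0 < \sum_i z i &
    forall i, \sum_j S i j * z j <= 0].
Proof.
move=> sk; apply: contrapT => nz.
pose a (s : I + I) (z : {ffun I -> R^o}) : R :=
  match s with inl i => - z i | inr i => \sum_j S i j * z j end.
pose b (z : {ffun I -> R^o}) : R := \sum_i z i.
have la s : scalar (a s).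
  case: s => i k u v /=; first by rewrite !ffunE /GRing.scale /=; ring.
  rewrite mulr_sumr -big_split; apply: eq_bigr => j _.
  by rewrite !ffunE /GRing.scale /=; ring.
have lb : scalar b.
  by move=> k u v; rewrite /b mulr_sumr -big_split; apply: eq_bigr => j _; rewrite !ffunE.
case: (farkas (index_enum_uniq (I + I)%type) la lb) => [z hz|c [c0 cE]].
  rewrite leNgt; apply/negP => z0; apply: nz; exists z; split=> // i.
    by have := hz (inl i) (mem_index_enum _); rewrite /= oppr_le0.
  exact: (hz (inr i) (mem_index_enum _)).
have cE' z : b z = - \sum_i c (inl i) * z i + \sum_i c (inr i) * \sum_j S i j * z j.
  rewrite cE big_sumType /= -sumrN; congr (_ + _).
  by apply: eq_bigr => i _; rewrite mulrN.
(* Evaluating the Farkas identity at [z = c \o inr] makes the skew form vanish,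
   so all these multipliers are zero. *)
have skq (z : I -> R) : \sum_i z i * \sum_j S i j * z j = 0.
  set s := LHS; suff : s = - s by lra.
  rewrite {1}/s; under eq_bigr do rewrite mulr_sumr.
  rewrite exchange_big -sumrN; apply: eq_bigr => i _.
  rewrite mulr_sumr -sumrN; apply: eq_bigr => j _; rewrite sk; ring.
have cr0 i : c (inr i) = 0.
  have := cE' ([ffun i => c (inr i)] : {ffun I -> R^o}); rewrite /b.
  under eq_bigr do rewrite ffunE.
  under [X in _ = _ + X]eq_bigr do under eq_bigr do rewrite ffunE.
  rewrite skq addr0 => e.
  have e0 : \sum_i c (inr i) = 0.
    apply/eqP; rewrite eq_le sumr_ge0 // andbT e oppr_le0 sumr_ge0 // => j _.
    by rewrite ffunE mulr_ge0.
  by apply/eqP; move/eqP: e0; rewrite psumr_eq0 // => /allP/(_ i (mem_index_enum _)).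
(* Only the sign constraints are left: at the all-ones vector a positive sum would equal a
   nonpositive one. *)
have := cE' ([ffun=> 1] : {ffun I -> R^o}).
rewrite [X in _ + X]big1 => [|i _]; last by rewrite cr0 mul0r.
rewrite addr0 /b; under eq_bigr do rewrite ffunE.
under [X in _ = - X]eq_bigr do rewrite ffunE mulr1.
have : 0 <= \sum_i c (inl i) by apply: sumr_ge0.
have : 0 < \sum_(i : I) (1 : R).
  by rewrite (bigD1 i0) //= ltr_wpDr // sumr_ge0.
by lra.
Qed.

(** The kernel vector of the symmetrized game splits into row weights of mass [al], column weights
    of mass [be] and a scalar [la]. Positive payoffs force all three to be positive, and normalizing
    the weights gives optimal mixed strategies. *)
Lemma minimax (R : realFieldType) (I J : finType) (g : I -> J -> R) (i0 : I) (j0 : J) :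
  exists (mu : I -> R) (nu : J -> R) (v : R),
    [/\ forall i, 0 <= mu i, \sum_i mu i = 1, forall j, 0 <= nu j & \sum_j nu j = 1] /\
    (forall j, v <= \sum_i mu i * g i j) /\ (forall i, \sum_j nu j * g i j <= v).
Proof.
pose m := 1 + \sum_i \sum_j `|g i j|.
have gm i j : 0 < g i j + m.
  rewrite /m (bigD1 i) //= (bigD1 j) //=.
  have : 0 <= \sum_(j' | j' != j) `|g i j'| by apply: sumr_ge0.
  have : 0 <= \sum_(i' | i' != i) \sum_j' `|g i' j'| by do 2!apply: sumr_ge0 => *.
  by have := ler_norm (- g i j); rewrite normrN; lra.
(* Symmetrization of the game, shifted by [m] to have positive payoffs. *)
pose S (s t : (I + J + unit)%type) : R := match s, t with
  | inl (inl i), inl (inr j) => g i j + m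
  | inl (inr j), inl (inl i) => - (g i j + m)
  | inl (inl _), inr _ => - 1 | inr _, inl (inl _) => 1
  | inl (inr _), inr _ => 1 | inr _, inl (inr _) => - 1
  | _, _ => 0 end.
have sumE (f : (I + J + unit)%type -> R) : \sum_s f s =
    f (inr tt) + (\sum_i f (inl (inl i)) + \sum_j f (inl (inr j))).
  by rewrite big_sumType big_sumType addrC; congr (_ + _); rewrite (big_pred1 tt) //; case.
have [|z [z0 zs zS]] := @skew_kernel R _ S (inr tt).
  by move=> [[i|j]|[]] [[i'|j']|[]] /=; rewrite ?oppr0 ?opprK.
set la := z (inr tt); pose al := \sum_i z (inl (inl i)); pose be := \sum_j z (inl (inr j)).
have ab : al <= be.
  have := zS (inr tt); rewrite sumE /=; under eq_bigr do rewrite mul1r.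
  under [X in _ + (_ + X)]eq_bigr do rewrite mulN1r.
  by rewrite sumrN mul0r -/al -/be; lra.
have HI i : \sum_j z (inl (inr j)) * (g i j + m) <= la.
  have := zS (inl (inl i)); rewrite sumE /=.
  rewrite [X in _ + (X + _)]big1 => [|j _]; last by rewrite mul0r.
  under eq_bigr do rewrite mulrC.
  by rewrite -/la; lra.
have HJ j : la <= \sum_i z (inl (inl i)) * (g i j + m).
  have := zS (inl (inr j)); rewrite sumE /=.
  rewrite [X in _ + (_ + X)]big1 => [|i _]; last by rewrite mul0r.
  under eq_bigr do rewrite mulNr mulrC.
  by rewrite sumrN -/la; lra.
have al0' : 0 <= al by apply: sumr_ge0.
have la0' : 0 <= la by apply: z0.
have be_al : 0 < be.
  rewrite lt_neqAle (le_trans al0' ab) andbT; apply/eqP => be0.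
  have zj j : z (inl (inr j)) = 0.
    by apply/eqP; move/esym/eqP: be0; rewrite psumr_eq0 // => /allP/(_ j (mem_index_enum _)).
  have al0 : al = 0 by lra.
  have zi i : z (inl (inl i)) = 0.
    by apply/eqP; move/eqP: al0; rewrite psumr_eq0 // => /allP/(_ i (mem_index_enum _)).
  have := HJ j0; rewrite big1 => [|i _]; last by rewrite zi mul0r.
  by move: zs; rewrite sumE -/la -/al -/be -be0 al0; lra.
have la0 : 0 < la.
  rewrite lt_neqAle la0' andbT; apply/eqP => l0; move: be_al.
  rewrite ltNge => /negP; apply; rewrite sumr_le0 // => j _.
  have := HI i0; rewrite -l0 (bigD1 j) //= => h.
  have h2 : 0 <= \sum_(j' | j' != j) z (inl (inr j')) * (g i0 j' + m).
    by apply: sumr_ge0 => j' _; rewrite mulr_ge0 // ltW.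
  by rewrite -(pmulr_lle0 _ (gm i0 j)); lra.
have al0 : 0 < al.
  rewrite lt_neqAle al0' andbT; apply/eqP => a0; move: la0.
  rewrite ltNge => /negP; apply; apply: le_trans (HJ j0) _; rewrite sumr_le0 // => i _.
  have : z (inl (inl i)) = 0.
    by apply/eqP; move/esym/eqP: a0; rewrite psumr_eq0 // => /allP/(_ i (mem_index_enum _)).
  by move->; rewrite mul0r.
(* In the shifted game the rows guarantee [la / al] and the columns concede at most [la / be], which
   is no larger since [al <= be]. *)
exists (fun i => z (inl (inl i)) / al), (fun j => z (inl (inr j)) / be), (la / al - m).
split; first split=> *.
- by rewrite divr_ge0 ?z0 // ltW.
- by rewrite -mulr_suml divff ?gt_eqF.
- by rewrite divr_ge0 ?z0 // ltW.
- by rewrite -mulr_suml divff ?gt_eqF.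
split=> [j|i].
- rewrite lerBlDr; have <- : (\sum_i z (inl (inl i)) * (g i j + m)) / al =
      \sum_i z (inl (inl i)) / al * g i j + m.
    under eq_bigr do rewrite mulrDr.
    rewrite big_split -mulr_suml mulrDl mulrAC divff ?gt_eqF // mul1r mulr_suml.
    by congr (_ + _); apply: eq_bigr => i _; rewrite mulrAC.
  by rewrite ler_pM2r ?invr_gt0.
- rewrite lerBrDr; have <- : (\sum_j z (inl (inr j)) * (g i j + m)) / be =
      \sum_j z (inl (inr j)) / be * g i j + m.
    under eq_bigr do rewrite mulrDr.
    rewrite big_split -mulr_suml mulrDl mulrAC divff ?gt_eqF // mul1r mulr_suml.
    by congr (_ + _); apply: eq_bigr => j _; rewrite mulrAC.
  apply: le_trans (_ : la / be <= _); first by rewrite ler_pM2r ?invr_gt0.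
  by rewrite ler_pM2l // lef_pV2.
Qed.

(** * Sums over pairs of histories of a given length *)

Section Histories.
Variables (R : realType) (A B : finType).
Implicit Types f g : seq A -> seq B -> R.

Definition hsum n f : R := \sum_(hA : n.-tuple A) \sum_(hB : n.-tuple B) f hA hB.

Lemma big_tuple_rcons (C : finType) n (f : seq C -> R) :
  \sum_(h : n.+1.-tuple C) f h = \sum_(h : n.-tuple C) \sum_c f (rcons h c).
Proof.
rewrite pair_big /=.
rewrite (reindex (fun u : n.-tuple C * C => [tuple of rcons u.1 u.2])) //.
apply: onW_bij; apply: inj_card_bij => [[h c] [h' c'] /(congr1 val)/= /rcons_inj[e ->]|].
  by congr (_, _); apply: val_inj.
by rewrite card_prod !card_tuple expnSr.
Qed.

Lemma hsum0 f : hsum 0 f = f [::] [::].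
Proof.
rewrite /hsum (big_pred1 [tuple]) => [|t]; last exact/esym/eqP/tuple0.
by rewrite (big_pred1 [tuple]) => [|t] //; exact/esym/eqP/tuple0.
Qed.

Lemma hsumS n f :
  hsum n.+1 f = hsum n (fun hA hB => \sum_a \sum_b f (rcons hA a) (rcons hB b)).
Proof.
rewrite /hsum (big_tuple_rcons n (fun h => \sum_(hB : n.+1.-tuple B) f h hB)).
apply: eq_bigr => h _; rewrite [RHS]exchange_big; apply: eq_bigr => a _.
exact: (big_tuple_rcons n (fun hB => f (rcons h a) hB)).
Qed.

Lemma eq_hsum n f g : (forall hA hB, size hA = n -> size hB = n -> f hA hB = g hA hB) ->
  hsum n f = hsum n g.
Proof. by move=> fg; do 2!apply: eq_bigr => ? _; rewrite fg ?size_tuple. Qed.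

Lemma hsum_eq0 n f : (forall hA hB, size hA = n -> size hB = n -> f hA hB = 0) ->
  hsum n f = 0.
Proof. by move=> f0; do 2!apply: big1 => ? _; rewrite f0 ?size_tuple. Qed.

Lemma hsum_ge0 n f : (forall hA hB, size hA = n -> size hB = n -> 0 <= f hA hB) ->
  0 <= hsum n f.
Proof. by move=> f0; do 2!apply: sumr_ge0 => ? _; rewrite f0 ?size_tuple. Qed.

Lemma hsum_sum (I : finType) n (f : I -> seq A -> seq B -> R) :
  hsum n (fun hA hB => \sum_i f i hA hB) = \sum_i hsum n (f i).
Proof.
by rewrite /hsum; under eq_bigr do rewrite exchange_big; rewrite exchange_big.
Qed.

Lemma hsumD n f g :
  hsum n (fun hA hB => f hA hB + g hA hB) = hsum n f + hsum n g.
Proof. by rewrite /hsum -big_split; apply: eq_bigr => ? _; rewrite -big_split. Qed.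

Lemma hsumM n c f : hsum n (fun hA hB => c * f hA hB) = c * hsum n f.
Proof. by rewrite /hsum mulr_sumr; apply: eq_bigr => ? _; rewrite mulr_sumr. Qed.

End Histories.

Lemma hsum_swap (R : realType) (A B : finType) n (f : seq A -> seq B -> R) :
  hsum n (fun hB hA => f hA hB) = hsum n f.
Proof. exact: exchange_big. Qed.

(* Exchanges the two histories, turning objects of player 2 into objects of
   player 1 of the game with the players exchanged. *)
Definition swp {I C D X : Type} (f : I -> seq C -> seq D -> X) i hD hC := f i hC hD.

(** * Realization plans of behavior strategies *)

Section Plan.
Variables (R : realType) (I C D : finType) (c : I -> R) (T : nat).
Implicit Types (s x : I -> seq C -> seq D -> C -> R).

(** Own history comes first, so player 2 is covered through [swp]. The action [d] doubles as the
    default of [nth], which is never reached. *)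
Definition plan s i hC hD d : R :=
  c i * \prod_(j < size hC) s i (take j hC) (take j hD) (nth d hC j) * s i hC hD d.

Lemma plan_nil s i d : plan s i [::] [::] d = c i * s i [::] [::] d.
Proof. by rewrite /plan big_ord0 mulr1. Qed.

Lemma plan_rcons s i hC hD a b d : size hC = size hD ->
  plan s i (rcons hC a) (rcons hD b) d =
  plan s i hC hD a * s i (rcons hC a) (rcons hD b) d.
Proof.
move=> sz; rewrite /plan size_rcons big_ord_recr /=; congr (_ * _).
rewrite -mulrA; congr (_ * _).
have tD : take (size hC) hD = hD by rewrite sz take_size.
rewrite -!cats1 !takel_cat -?sz // take_size tD nth_cat ltnn subnn /=.
congr (_ * _); apply: eq_bigr => j _.
rewrite !takel_cat -?sz 1?ltnW // nth_cat ltn_ord; congr (s _ _ _ _).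
by apply: set_nth_default.
Qed.

Lemma realX_plan s : (forall i, 0 <= c i) -> strategy1 T s -> (0 < T)%N ->
  Defs.realX c T (plan s).
Proof.
move=> c0 hs hT; split; [|split].
- move=> i hC hD a /andP[/eqP sz szT].
  rewrite mulr_ge0 ?mulr_ge0 ?c0 ?prodr_ge0 // => [j _|].
    case: (hs i (take j hC) (take j hD)) => //.
    rewrite /is_hist !size_take -sz eqxx ltn_ord /=.
    exact: ltn_trans szT.
  by case: (hs i hC hD) => //; rewrite /is_hist sz eqxx -sz.
- move=> i; under eq_bigr do rewrite plan_nil.
  by rewrite -mulr_sumr (proj2 (hs i [::] [::] _)) ?mulr1 // /is_hist.
- move=> i hC hD a b /andP[/eqP sz _] szT.
  under eq_bigr do rewrite plan_rcons //.
  rewrite -mulr_sumr (proj2 (hs i (rcons hC a) (rcons hD b) _)) ?mulr1 //.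
  by rewrite /is_hist !size_rcons sz eqxx -sz.
Qed.

(** Induction on the history. Where the parent entry is zero, [induced1] leaves [s] free, but flow
    and nonnegativity make the child entry vanish as well. *)
Lemma plan_induced s x : (forall i, 0 < c i) -> Defs.realX c T x -> induced1 c T x s ->
  forall i hC hD d, is_hist T hC hD -> x i hC hD d = plan s i hC hD d.
Proof.
move=> c0 [x0 [x1 xS]] [s0 sS] i; elim/last_ind => [|hC a IH] hD d /andP[sz szT].
  case: hD sz => // _; rewrite plan_nil s0 mulrC divfK //; exact: lt0r_neq0.
case/lastP: hD sz => [|hD b]; first by rewrite size_rcons.
rewrite !size_rcons in szT *; rewrite eqSS => sz.
have hh : is_hist T hC hD by rewrite /is_hist sz ltnW.
rewrite plan_rcons ?(eqP sz) // -IH //.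
have [xa0|xa0] := eqVneq (x i hC hD a) 0; last by rewrite sS // mulrC divfK.
rewrite xa0 mul0r.
have := xS i hC hD a b hh szT; rewrite xa0 => /eqP.
rewrite psumr_eq0 => [/allP/(_ d (mem_index_enum _))/eqP //|d' _].
by apply: x0; rewrite /is_hist !size_rcons eqSS sz.
Qed.

End Plan.

(** * The payoff as a bilinear form in the two plans *)

Section Payoff.
Variables (R : realType) (K L A B : finType).
Variables (M : K -> L -> A -> B -> R) (T : nat).
Implicit Types (x : K -> seq A -> seq B -> A -> R) (y : L -> seq A -> seq B -> B -> R).

(** Summed stage by stage. For plans of strategies the priors are already inside [x] and [y], so
    their product is the joint probability of types, history and current actions. *)
Definition payoff x y : R :=
  \sum_k \sum_l \sum_(t < T) hsum t (fun hA hB =>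
    \sum_a \sum_b M k l a b * (x k hA hB a * y l hA hB b)).

Lemma eq_payoff x x' y y' :
  (forall k hA hB a, is_hist T hA hB -> x k hA hB a = x' k hA hB a) ->
  (forall l hA hB b, is_hist T hA hB -> y l hA hB b = y' l hA hB b) ->
  payoff x y = payoff x' y'.
Proof.
move=> xx yy; apply: eq_bigr => k _; apply: eq_bigr => l _; apply: eq_bigr => t _.
apply: eq_hsum => hA hB sA sB; apply: eq_bigr => a _; apply: eq_bigr => b _.
by rewrite xx ?yy // /is_hist sA sB eqxx ltn_ord.
Qed.

Lemma payoff_mixl (I : finType) (mu : I -> R) X y :
  payoff (fun k hA hB a => \sum_(i : I) mu i * X i k hA hB a) y =
  \sum_i mu i * payoff (X i) y.
Proof.
under [RHS]eq_bigr do rewrite mulr_sumr.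
rewrite [RHS]exchange_big; apply: eq_bigr => k _ /=.
under [RHS]eq_bigr do rewrite mulr_sumr.
rewrite [RHS]exchange_big; apply: eq_bigr => l _ /=.
under [RHS]eq_bigr do rewrite mulr_sumr.
rewrite [RHS]exchange_big; apply: eq_bigr => t _ /=.
under [RHS]eq_bigr do rewrite -hsumM.
rewrite -hsum_sum; apply: eq_hsum => hA hB _ _.
under [RHS]eq_bigr do rewrite mulr_sumr.
rewrite [RHS]exchange_big; apply: eq_bigr => a _ /=.
under [RHS]eq_bigr do rewrite mulr_sumr.
rewrite [RHS]exchange_big; apply: eq_bigr => b _ /=.
by rewrite mulr_suml mulr_sumr; apply: eq_bigr => i _; ring.
Qed.

(** Induction on the number [n] of stages played: [w n] is the probability of the types and the
    first [n] moves, [m n] the payoff accumulated so far. *)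
Lemma gammaT_payoff (p : K -> R) (q : L -> R) s t : (0 < #|A|)%N -> (0 < #|B|)%N ->
  strategy1 T s -> strategy2 T t ->
  gammaT M p q T s t = payoff (plan p s) (swp (plan q (swp t))).
Proof.
case/card_gt0P => a0 _ /card_gt0P[b0 _] hs ht.
apply: eq_bigr => k _; apply: eq_bigr => l _.
pose w n hA hB := p k * q l * \prod_(j < n)
  (s k (take j hA) (take j hB) (nth a0 hA j) * t l (take j hA) (take j hB) (nth b0 hB j)).
pose m n hA hB := \sum_(j < n) M k l (nth a0 hA j) (nth b0 hB j).
transitivity (hsum T (fun hA hB => w T hA hB * m T hA hB)).
  rewrite /hsum /play_prob /w /m; apply: eq_bigr => hA _; apply: eq_bigr => hB _.
  by congr (_ * _ * _); apply: eq_bigr => j _; rewrite -!tnth_nth.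
have wS n hA hB a b : size hA = n -> size hB = n -> w n.+1 (rcons hA a) (rcons hB b) =
    w n hA hB * (s k hA hB a * t l hA hB b).
  move=> sA sB; rewrite /w big_ord_recr /= -[RHS]mulrA; congr (_ * (_ * _)).
    apply: eq_bigr => j _; rewrite -!cats1 !takel_cat ?sA ?sB 1?ltnW //.
    by rewrite !nth_cat sA sB ltn_ord.
  rewrite -!cats1 !takel_cat ?sA ?sB // !nth_cat sA sB ltnn subnn /=.
  by rewrite -[n in take n hA]sA -[n in take n hB]sB !take_size.
have wE n hA hB a b : size hA = n -> size hB = n ->
    w n hA hB * (s k hA hB a * t l hA hB b) =
    plan p s k hA hB a * swp (plan q (swp t)) l hA hB b.
  move=> sA sB; rewrite /w /plan /swp big_split /=.
  have -> : \prod_(j < size hA) s k (take j hA) (take j hB) (nth a hA j) =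
      \prod_(j < n) s k (take j hA) (take j hB) (nth a0 hA j).
    rewrite sA; apply: eq_bigr => j _; congr (s _ _ _ _).
    by apply: set_nth_default; rewrite sA.
  have -> : \prod_(j < size hB) t l (take j hA) (take j hB) (nth b hB j) =
      \prod_(j < n) t l (take j hA) (take j hB) (nth b0 hB j).
    rewrite sB; apply: eq_bigr => j _; congr (t _ _ _ _).
    by apply: set_nth_default; rewrite sB.
  by ring.
suff /(_ T (leqnn T)) : forall n, (n <= T)%N ->
  hsum n (fun hA hB => w n hA hB * m n hA hB) =
  \sum_(j < n) hsum j (fun hA hB => \sum_a \sum_b
     M k l a b * (plan p s k hA hB a * swp (plan q (swp t)) l hA hB b)) by [].
elim=> [_|n IH nT]; first by rewrite hsum0 big_ord0 /m big_ord0 mulr0.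
rewrite hsumS big_ord_recr /= -IH 1?ltnW // -hsumD; apply: eq_hsum => hA hB sA sB.
have hh : is_hist T hA hB by rewrite /is_hist sA sB eqxx.
(* The last move adds one stage payoff. In the earlier payoffs it only contributes its
   probabilities, which sum to one. *)
transitivity (\sum_a \sum_b (w n hA hB * m n hA hB * (s k hA hB a * t l hA hB b) +
    M k l a b * (plan p s k hA hB a * swp (plan q (swp t)) l hA hB b))).
  apply: eq_bigr => a _; apply: eq_bigr => b _.
  rewrite wS // -(@wE n) // /m big_ord_recr /= !nth_rcons sA sB ltnn eqxx.
  under eq_bigr do rewrite !nth_rcons sA sB ltn_ord.
  by ring.
under [LHS]eq_bigr => a _ do rewrite big_split /=.
rewrite big_split /=; congr (_ + _).
under eq_bigr do rewrite -mulr_sumr -mulr_sumr (proj2 (ht l hA hB hh)) mulr1.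
by rewrite -mulr_sumr (proj2 (hs k hA hB hh)) mulr1.
Qed.

End Payoff.

Lemma payoff_swap (R : realType) (K L A B : finType) (M : K -> L -> A -> B -> R) T x y :
  payoff (fun l k b a => - M k l a b) T (swp y) (swp x) = - payoff M T x y.
Proof.
rewrite /payoff exchange_big -sumrN; apply: eq_bigr => k _ /=.
rewrite -sumrN; apply: eq_bigr => l _; rewrite -sumrN; apply: eq_bigr => t _.
rewrite -[RHS]mulN1r -hsumM -hsum_swap; apply: eq_hsum => hB hA _ _.
rewrite mulr_sumr exchange_big; apply: eq_bigr => a _ /=.
by rewrite mulr_sumr; apply: eq_bigr => b _; rewrite /swp; ring.
Qed.

(** * Pure strategies, mixtures of plans and induced strategies *)

Section PlanExistence.
Variables (R : realType) (I C D : finType) (c : I -> R) (T : nat).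
Implicit Types (s x : I -> seq C -> seq D -> C -> R).

(* [insub_bseq] is the identity on histories of length at most [T] and returns
   the empty sequence on longer ones, whose values are irrelevant. *)
Definition pure (f : {ffun I * T.-bseq C * T.-bseq D -> C}) i hC hD d : R :=
  (d == f (i, insub_bseq T hC, insub_bseq T hD))%:R.

Lemma strategy1_pure f : strategy1 T (pure f).
Proof.
move=> i hC hD _; split=> [d|]; first exact: ler0n.
rewrite (bigD1 (f (i, insub_bseq T hC, insub_bseq T hD))) //= /pure eqxx big1 ?addr0 //.
by move=> d /negPf ->.
Qed.

Lemma realX_mix (J : finType) (mu : J -> R) (X : J -> I -> seq C -> seq D -> C -> R) :
  (forall j, 0 <= mu j) -> \sum_j mu j = 1 -> (forall j, Defs.realX c T (X j)) ->
  Defs.realX c T (fun i hC hD d => \sum_j mu j * X j i hC hD d).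
Proof.
move=> mu0 mu1 hX; split; [|split].
- by move=> i hC hD d h; apply: sumr_ge0 => j _; rewrite mulr_ge0 // (proj1 (hX j)).
- move=> i; rewrite exchange_big -[RHS]mul1r -mu1 mulr_suml; apply: eq_bigr => j _.
  by rewrite -mulr_sumr (proj1 (proj2 (hX j))).
- move=> i hC hD a b h hT; rewrite exchange_big; apply: eq_bigr => j _.
  by rewrite -mulr_sumr (proj2 (proj2 (hX j))).
Qed.

Lemma exists_induced x : (0 < #|C|)%N -> (forall i, 0 < c i) -> Defs.realX c T x ->
  exists s, strategy1 T s /\ induced1 c T x s.
Proof.
case/card_gt0P => d0 _ c0 [x0 [x1 xS]].
(* Dividing by the mass of [x] at the history itself, which flow equates with the parent entry (the
   prior at stage 1), covers all stages at once. Histories of mass zero get the fixed action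
   [d0]. *)
exists (fun i hC hD d => let z := \sum_e x i hC hD e in
  if z == 0 then (d == d0)%:R else x i hC hD d / z); split; [|split].
- move=> i hC hD h /=; case: eqP => [_|/eqP z0]; split.
  + by move=> d; rewrite ler0n.
  + by rewrite (bigD1 d0) //= eqxx big1 ?addr0 // => d /negPf ->.
  + by move=> d; rewrite divr_ge0 ?x0 // sumr_ge0 // => e _; rewrite x0.
  + by rewrite -mulr_suml divff.
- by move=> i d /=; rewrite x1 gt_eqF.
- by move=> i hC hD a b h hT nz d /=; rewrite xS // (negPf nz).
Qed.

End PlanExistence.

(** * Exchange of the two players *)

Lemma is_histC (C D : finType) T (hC : seq C) (hD : seq D) : is_hist T hC hD -> is_hist T hD hC.
Proof. by rewrite /is_hist eq_sym; case/andP=> /eqP ->; rewrite eqxx. Qed.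

Lemma hist_size (C D : finType) T (hC : seq C) (hD : seq D) : is_hist T hC hD -> size hC = size hD.
Proof. by case/andP=> /eqP. Qed.

Section Swap.
Variables (R : realType) (I C D : finType) (c : I -> R) (T : nat).
Implicit Types (y t : I -> seq C -> seq D -> D -> R).

Lemma realY_swp y : realY c T y <-> Defs.realX c T (swp y).
Proof.
split=> -[y0 [y1 yS]]; split; [|split| |split] => //.
- by move=> i hD hC d /is_histC h; apply: y0.
- move=> i hD hC d b h hT;
  apply: (yS i hC hD b d); rewrite ?(hist_size (is_histC h)) //.
  exact: is_histC.
- by move=> i hC hD d /is_histC h; apply: y0.
- move=> i hC hD b d h hT;
  apply: (yS i hD hC d b); rewrite -?(hist_size h) //.
  exact: is_histC.
Qed.

Lemma strategy2_swp t : strategy2 T t <-> strategy1 T (swp t).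
Proof.
by split=> ht i h h' hh; apply: (ht i h' h (is_histC hh)).
Qed.

Lemma induced2_swp y t : induced2 c T y t <-> induced1 c T (swp y) (swp t).
Proof.
split=> -[t0 tS]; split => //.
- move=> i hD hC d b h hT;
  apply: (tS i hC hD b d); rewrite ?(hist_size (is_histC h)) //.
  exact: is_histC.
- move=> i hC hD b d h hT;
  apply: (tS i hD hC d b); rewrite -?(hist_size h) //.
  exact: is_histC.
Qed.
End Swap.

(** * Telescoping along a plan, and backward induction *)

Section Telescope.
Variables (R : realType) (A B : finType) (n : nat).

(** Summation by parts: flow turns the sum of [V] over successors at stage [t] into the total of [V]
    at the next stage. The last bracket is the slack of a constraint of the program; it will be
    nonnegative for weak duality, and zero where [y] is positive for a best reply. *)
Lemma hsum_slack (y c : seq A -> seq B -> B -> R) (V : seq A -> seq B -> R) :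
  (0 < n)%N ->
  (forall hA hB a b, size hA = size hB -> ((size hA).+1 < n)%N ->
     \sum_b' y (rcons hA a) (rcons hB b) b' = y hA hB b) ->
  (forall hA hB, size hA = n -> size hB = n -> V hA hB = 0) ->
  \sum_(t < n) hsum t (fun hA hB => \sum_b y hA hB b * c hA hB b) =
  (\sum_b y [::] [::] b) * V [::] [::] +
  \sum_(t < n) hsum t (fun hA hB => \sum_b y hA hB b *
     (c hA hB b + \sum_a V (rcons hA a) (rcons hB b) - V hA hB)).
Proof.
move=> n0 flow V0.
(* Flow gives no plan entries at length [n]. Setting [E n] to zero agrees with [V] vanishing there,
   so [ES] also holds at the last stage. *)
pose E t := if (t < n)%N then hsum t (fun hA hB => \sum_b y hA hB b * V hA hB) else 0.
have ES (t : 'I_n) : E t.+1 =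
    hsum t (fun hA hB => \sum_b y hA hB b * \sum_a V (rcons hA a) (rcons hB b)).
  rewrite /E; case: ltnP => tn; last first.
    have {}tn : t.+1 = n by apply/eqP; rewrite eqn_leq tn ltn_ord.
    rewrite hsum_eq0 // => hA hB sA sB.
    rewrite big1 // => b _; rewrite big1 ?mulr0 // => a _.
    by rewrite V0 // size_rcons ?sA ?sB.
  rewrite hsumS; apply: eq_hsum => hA hB sA sB.
  under [RHS]eq_bigr do rewrite mulr_sumr.
  rewrite [RHS]exchange_big; apply: eq_bigr => a _; apply: eq_bigr => b _.
  by rewrite -mulr_suml flow // sA.
have -> : (\sum_b y [::] [::] b) * V [::] [::] = E 0%N.
  by rewrite /E n0 hsum0 mulr_suml.
have En : E n = 0 by rewrite /E ltnn.
have tel : \sum_(t < n) (E t.+1 - E t) = E n - E 0%N.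
  by rewrite -(big_mkord xpredT (fun t => E t.+1 - E t)) telescope_sumr.
suff -> : \sum_(t < n) hsum t (fun hA hB => \sum_b y hA hB b *
     (c hA hB b + \sum_a V (rcons hA a) (rcons hB b) - V hA hB)) =
  \sum_(t < n) hsum t (fun hA hB => \sum_b y hA hB b * c hA hB b) +
  \sum_(t < n) (E t.+1 - E t).
  by rewrite tel En; ring.
rewrite -big_split; apply: eq_bigr => t _ /=.
rewrite ES /E ltn_ord -[- hsum _ _]mulN1r -hsumM -!hsumD; apply: eq_hsum => hA hB _ _.
rewrite mulr_sumr -!big_split; apply: eq_bigr => b _ /=; ring.
Qed.

End Telescope.

Section BestReply.
Variables (R : realType) (A B : finType) (c : seq A -> seq B -> B -> R) (b0 : B).

(** Dynamic programming for the minimizer with [n] stages to go. The opponent's actions are summed,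
    not averaged, because the costs [c] will already carry the weights of the opponent's plan. *)
Fixpoint bestval n hA hB : R :=
  if n is m.+1 then
    let F b := c hA hB b + \sum_a bestval m (rcons hA a) (rcons hB b) in
    F [arg min_(b < b0) F b]%O
  else 0.

Definition bestact n hA hB : B :=
  [arg min_(b < b0) (c hA hB b + \sum_a bestval n.-1 (rcons hA a) (rcons hB b))]%O.

Lemma bestval_le n hA hB b :
  bestval n.+1 hA hB <= c hA hB b + \sum_a bestval n (rcons hA a) (rcons hB b).
Proof. by rewrite /=; case: Order.TotalTheory.arg_minP => // i _ ->. Qed.

Lemma bestvalE n hA hB : let b := bestact n.+1 hA hB in
  bestval n.+1 hA hB = c hA hB b + \sum_a bestval n (rcons hA a) (rcons hB b).
Proof. by []. Qed.

End BestReply.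

(** * The primal program: weak duality, best replies and security *)

Section LP.
Variables (R : realType) (K L A B : finType).
Variables (M : K -> L -> A -> B -> R) (p : K -> R) (q : L -> R) (T : nat).
Implicit Types (x : K -> seq A -> seq B -> A -> R) (y : L -> seq A -> seq B -> B -> R).

Definition stage_payoff x l hA hB b : R := \sum_k \sum_a M k l a b * x k hA hB a.

Lemma payoff_stage x y : payoff M T x y =
  \sum_l \sum_(t < T) hsum t (fun hA hB => \sum_b y l hA hB b * stage_payoff x l hA hB b).
Proof.
rewrite /payoff exchange_big; apply: eq_bigr => l _ /=.
rewrite exchange_big; apply: eq_bigr => t _ /=.
rewrite -hsum_sum; apply: eq_hsum => hA hB _ _.
under [RHS]eq_bigr do rewrite mulr_sumr.
rewrite [RHS]exchange_big; apply: eq_bigr => k _ /=.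
rewrite exchange_big; apply: eq_bigr => b _ /=.
by rewrite mulr_sumr; apply: eq_bigr => a _; ring.
Qed.

(** By [hsum_slack], the payoff exceeds the objective by the constraint slacks weighted with [y]. *)
Lemma primal_payoff x y (u0 : L -> R) u : (0 < T)%N -> realY q T y ->
  primal_feas M p T x u0 u -> primal_obj q u0 <= payoff M T x y.
Proof.
move=> T0 [y0 [y1 yS]] [_ [feas0 feasS]]; rewrite payoff_stage.
apply: ler_sum => l _.
(* [V] is the right-hand side of the constraint attached to a history. *)
pose V hA hB := match rev hA, rev hB with
  | a :: rA, b :: rB => ucut T u l (rev rA) (rev rB) a b
  | _, _ => u0 l end.
have VS hA hB a b : V (rcons hA a) (rcons hB b) = ucut T u l hA hB a b.
  by rewrite /V !rev_rcons !revK.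
rewrite (@hsum_slack R A B T (y l) (stage_payoff x l) V) //.
- rewrite y1 lerDl; apply: sumr_ge0 => t _; apply: hsum_ge0 => hA hB sA sB.
  have hh : is_hist T hA hB by rewrite /is_hist sA sB eqxx ltn_ord.
  apply: sumr_ge0 => b _; rewrite mulr_ge0 ?y0 // subr_ge0.
  under [X in _ <= _ + X]eq_bigr do rewrite VS.
  case/lastP: hA sA hh => [|hA a] sA; case/lastP: hB sB => [|hB b'] sB.
  + by move=> _; apply: feas0.
  + by rewrite /is_hist size_rcons.
  + by rewrite /is_hist size_rcons.
  + rewrite VS /is_hist !size_rcons eqSS => /andP[sz szT]; apply: feasS => //.
    by rewrite /is_hist sz ltnW.
- by move=> hA hB a b sz szT; rewrite yS // /is_hist sz eqxx -sz ltnW.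
(* Since [0 < T], a history of length [T] has a last move, and [V] is there a multiplier at length
   [T - 1], which [ucut] sets to zero. *)
- move=> hA hB; case/lastP: hA => [|hA a]; first by move=> eT; rewrite -eT in T0.
  case/lastP: hB => [|hB b]; first by move=> _ eT; rewrite -eT in T0.
  by rewrite VS /ucut size_rcons => ->; rewrite ltnn.
Qed.

(** Complementary slackness: backward induction values satisfy every constraint, with equality at
    the greedy action, so [hsum_slack] leaves only the objective. *)
Lemma exists_best_reply x : (0 < T)%N -> (0 < #|B|)%N -> (forall l, 0 <= q l) ->
  Defs.realX p T x ->
  exists (u0 : L -> R) u (f : {ffun L * T.-bseq B * T.-bseq A -> B}),
    primal_feas M p T x u0 u /\
    primal_obj q u0 = payoff M T x (swp (plan q (pure R f))).
Proof.
move=> T0 /card_gt0P[b0 _] q0 hx.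
pose W l := bestval (stage_payoff x l) b0.
pose u l (hA : seq A) (hB : seq B) a b := W l (T - (size hA).+1)%N (rcons hA a) (rcons hB b).
(* The cut-off is automatic: with no stage to go, [bestval] is zero. *)
have uE l hA hB a b : ucut T u l hA hB a b =
    W l (T - (size hA).+1)%N (rcons hA a) (rcons hB b).
  by rewrite /ucut; case: ltnP => // h; rewrite (eqP (_ : (T - _ == 0)%N)) // subn_eq0.
pose f := [ffun z : L * T.-bseq B * T.-bseq A =>
  bestact (stage_payoff x z.1.1) b0 (T - size z.2)%N z.2 z.1.2].
exists (fun l => W l T [::] [::]), u, f; split.
  split=> //; split=> [l b|l hA hB a b b' hh szT].
    under [X in _ + X]eq_bigr do rewrite uE.
    by have := bestval_le (stage_payoff x l) b0 T.-1 [::] [::] b; rewrite prednK // subn1.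
  under [X in _ + X]eq_bigr do rewrite uE.
  rewrite uE size_rcons.
  have -> : (T - (size hA).+1 = (T - (size hA).+2).+1)%N by rewrite -subnSK.
  exact: bestval_le.
rewrite payoff_stage; apply: eq_bigr => l _.
have [y0 [y1 yS]] : Defs.realX q T (plan q (pure R f)).
  by apply: realX_plan => //; apply: strategy1_pure.
rewrite (@hsum_slack R A B T _ _ (fun hA hB => W l (T - size hA)%N hA hB)) //.
- rewrite [X in _ = X + _](_ : _ = q l * W l T [::] [::]); last first.
    by congr (_ * _); rewrite ?subn0 // /swp y1.
  rewrite [X in _ = _ + X]big1 ?addr0 // => t _.
  rewrite hsum_eq0 // => hA hB sA sB.
  rewrite big1 // => b _; rewrite /swp /plan /pure.
  have -> : f (l, insub_bseq T hB, insub_bseq T hA) =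
      bestact (stage_payoff x l) b0 (T - t)%N hA hB.
    by rewrite ffunE /= /insub_bseq !insubdK ?sA // -topredE /= ?sA ?sB ltnW.
  (* The slack vanishes at the greedy action, the plan at every other one. *)
  case: eqP => [->|_]; last by rewrite mulr0 mul0r.
  have e : (T - size hA = (T - t.+1).+1)%N by rewrite sA subnSK.
  rewrite [X in _ * X](_ : _ = 0) ?mulr0 //.
  under eq_bigr do rewrite size_rcons sA.
  rewrite sA -(subnSK (ltn_ord t)) /W bestvalE; ring.
- by move=> hA hB a b sz szT; rewrite /swp yS -?sz // /is_hist sz eqxx -sz ltnW.
- by move=> hA hB sA _; rewrite sA subnn.
Qed.

(** On histories the plan of [s] is [x] by [plan_induced], so [primal_payoff] applies against the
    plan of any [t]. *)
Lemma primal_security x (u0 : L -> R) u s :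
  (forall k, 0 < p k) -> (forall l, 0 < q l) -> (0 < #|A|)%N -> (0 < #|B|)%N -> (0 < T)%N ->
  primal_feas M p T x u0 u -> strategy1 T s -> induced1 p T x s ->
  security1 M p q T (primal_obj q u0) s.
Proof.
move=> hp hq cA cB T0 feas hs ind; split=> // t ht.
rewrite gammaT_payoff //.
rewrite -(@eq_payoff R K L A B M T x _ (swp (plan q (swp t)))) //; last first.
  by move=> k hA hB a hh; apply: (plan_induced hp (proj1 feas)).
apply: primal_payoff feas => //; apply/realY_swp; apply: realX_plan => //.
  by move=> l; apply: ltW.
exact/strategy2_swp.
Qed.

(** Each constraint is multiplied by -1; this transfers the primal results to player 2. *)
Lemma dual_feas_swp y (w0 : K -> R) w : dual_feas M q T y w0 w <->
  primal_feas (fun l k b a => - M k l a b) q T (swp y) (fun k => - w0 k)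
    (fun k hB hA b a => - w k hA hB a b).
Proof.
pose w' k hB hA b a := - w k hA hB a b.
(* [ucut] measures only its first history, which the exchange replaces by the other one; hence the
   equal-length condition. *)
have cutN k hA hB a b : size hA = size hB -> ucut T w' k hB hA b a = - ucut T w k hA hB a b.
  by move=> sz; rewrite /ucut sz /w'; case: ifP; rewrite ?oppr0.
have stN k hA hB hA' hB' a : size hA = size hB ->
  \sum_l \sum_b - M k l a b * swp y l hB' hA' b + \sum_b ucut T w' k hB hA b a =
  - (\sum_l \sum_b M k l a b * y l hA' hB' b + \sum_b ucut T w k hA hB a b).
  move=> sz; rewrite opprD -!sumrN; congr (_ + _).
    by apply: eq_bigr => l _; rewrite -sumrN; apply: eq_bigr => b _; rewrite mulNr.
  by apply: eq_bigr => b _; rewrite cutN.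
rewrite /dual_feas /primal_feas -/w'.
split=> -[/realY_swp hy [feas0 feasS]]; split=> //; split.
- by move=> k a; rewrite stN // lerN2.
- move=> k hB hA b a a' /is_histC hh; rewrite -(hist_size hh) => szT.
  rewrite stN ?size_rcons ?(hist_size hh) // cutN ?(hist_size hh) // lerN2.
  exact: feasS.
- by move=> k a; rewrite -lerN2 -stN.
- move=> k hA hB a b a' hh szT.
  rewrite -lerN2 -stN ?size_rcons ?(hist_size hh) // -cutN ?(hist_size hh) //.
  by apply: feasS; [exact: is_histC | rewrite -(hist_size hh)].
Qed.

End LP.

(** * Strong duality of the two programs *)

Section Duality.
Variables (R : realType) (K L A B : finType).
Variables (M : K -> L -> A -> B -> R) (p : K -> R) (q : L -> R) (T : nat).
Let M' l k b a := - M k l a b.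
Hypotheses (hp : forall k, 0 < p k) (hq : forall l, 0 < q l).
Hypotheses (cA : (0 < #|A|)%N) (cB : (0 < #|B|)%N) (T0 : (0 < T)%N).

Lemma dual_objN (w0 : K -> R) : primal_obj p (fun k => - w0 k) = - dual_obj p w0.
Proof. by rewrite /primal_obj /dual_obj -sumrN; apply: eq_bigr => k _; rewrite mulrN. Qed.

Lemma dual_payoff x y (w0 : K -> R) w : Defs.realX p T x ->
  dual_feas M q T y w0 w -> payoff M T x y <= dual_obj p w0.
Proof.
move=> hx /dual_feas_swp feas; rewrite -lerN2 -dual_objN -payoff_swap.
by apply: primal_payoff feas => //; apply/realY_swp.
Qed.

Lemma dual_security y (w0 : K -> R) w t : dual_feas M q T y w0 w -> strategy2 T t ->
  induced2 q T y t -> security2 M p q T (dual_obj p w0) t.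
Proof.
move=> /dual_feas_swp feas ht /induced2_swp ind; split=> // s hs.
have [_ H] := primal_security hq hp cB cA T0 feas (proj1 (strategy2_swp _ _) ht) ind.
have hs' : strategy2 T (swp s) by apply/strategy2_swp.
have := H _ hs'; rewrite dual_objN !gammaT_payoff //; last exact/strategy2_swp.
by rewrite (payoff_swap M T (plan p s)) lerN2.
Qed.

Lemma strong_duality : exists x u0 u y w0 w,
  [/\ primal_feas M p T x u0 u, dual_feas M q T y w0 w & dual_obj p w0 <= primal_obj q u0].
Proof.
have [a0 _] := card_gt0P cA; have [b0 _] := card_gt0P cB.
pose X f := plan p (@pure R K A B T f); pose Y f := plan q (@pure R L B A T f).
have hX f : Defs.realX p T (X f).
  by apply: realX_plan => // [k|]; [exact: ltW | exact: strategy1_pure].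
have hY f : Defs.realX q T (Y f).
  by apply: realX_plan => // [l|]; [exact: ltW | exact: strategy1_pure].
have [mu [nu [v [[mu0 mu1 nu0 nu1] [Hmu Hnu]]]]] :=
  minimax (fun f g => payoff M T (X f) (swp (Y g))) [ffun=> a0] [ffun=> b0].
have hx := realX_mix mu0 mu1 hX; have hy := realX_mix nu0 nu1 hY.
have [u0 [u [g [feas obj]]]] := exists_best_reply M T0 cB (fun l => ltW (hq l)) hx.
have [w0 [w [f [feas' obj']]]] := exists_best_reply M' T0 cA (fun k => ltW (hp k)) hy.
exists (fun k hA hB a => \sum_f mu f * X f k hA hB a), u0, u.
exists (swp (fun l hB hA b => \sum_g nu g * Y g l hB hA b)), (fun k => - w0 k).
exists (fun k hA hB a b => - w k hB hA b a); split=> //.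
  apply/dual_feas_swp; rewrite (_ : (fun k => - - w0 k) = w0); last first.
    by apply/funext => k; rewrite opprK.
  rewrite (_ : (fun k hB hA b a => - - w k hB hA b a) = w) //.
  by do 5!apply/funext => ?; rewrite opprK.
(* The greedy replies [f] and [g] are pure, hence a row and a column of the matrix game: [Hnu]
   bounds the dual objective above by [v], and [Hmu] bounds the primal one below. *)
apply: (@le_trans _ _ v).
  rewrite -lerN2 -dual_objN (_ : (fun k => - - w0 k) = w0); last first.
    by apply/funext => k; rewrite opprK.
  rewrite obj' payoff_mixl.
  apply: le_trans (_ : - \sum_j nu j * payoff M T (X f) (swp (Y j)) <= _).
    by rewrite lerN2 Hnu.
  rewrite -sumrN; apply: ler_sum => j _.
  by rewrite -mulrN -payoff_swap.
by rewrite obj payoff_mixl Hmu.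
Qed.

End Duality.

Theorem theorem1 (R : realType) (K L A B : finType)
  (M : K -> L -> A -> B -> R) (p : K -> R) (q : L -> R) (T : nat)
  (hp : forall k, 0 < p k) (hp1 : \sum_(k : K) p k = 1)
  (hq : forall l, 0 < q l) (hq1 : \sum_(l : L) q l = 1)
  (hA : (0 < #|A|)%N) (hB : (0 < #|B|)%N) (hT : (0 < T)%N) :
  exists v : R,
    is_value M p q T v /\
    (* primal: V_T(p,q) = max of the LP, and optimal x gives a security strategy *)
    (exists x u0 u, primal_opt M p q T x u0 u) /\
    (forall x u0 u, primal_opt M p q T x u0 u ->
       primal_obj q u0 = v /\
       forall sigma, strategy1 T sigma -> induced1 p T x sigma ->
         security1 M p q T v sigma) /\
    (* dual: V_T(p,q) = min of the dual LP, and optimal y gives a security strategy *)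
    (exists y w0 w, dual_opt M p q T y w0 w) /\
    (forall y w0 w, dual_opt M p q T y w0 w ->
       dual_obj p w0 = v /\
       forall tau, strategy2 T tau -> induced2 q T y tau ->
         security2 M p q T v tau).
Proof.
have [x [u0 [u [y [w0 [w [fx fy gap]]]]]]] := strong_duality M hp hq hA hB hT.
have weak x' u0' u' y' w0' w' : primal_feas M p T x' u0' u' ->
    dual_feas M q T y' w0' w' -> primal_obj q u0' <= dual_obj p w0'.
  move=> fx' fy'; apply: le_trans (dual_payoff hT (proj1 fx') fy').
  exact: primal_payoff hT (proj1 fy') fx'.
have eqv : dual_obj p w0 = primal_obj q u0.
  by apply/eqP; rewrite eq_le gap (weak _ _ _ _ _ _ fx fy).
(* The strategies induced by [x] and [y] secure the common objective for either player. Any other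
   optimal solution is feasible with the same objective, so the security lemmas apply to it too. *)
exists (primal_obj q u0); split; [|split; [|split; [|split]]].
- split.
    have [s [hs ind]] := exists_induced hA hp (proj1 fx).
    by exists s; apply: primal_security fx hs ind.
  have [t [ht ind]] := exists_induced hB hq (proj1 (realY_swp _ _ _) (proj1 fy)).
  exists (swp t); rewrite -eqv; apply: (dual_security hp hq hA hB hT fy).
    exact/strategy2_swp.
  exact/induced2_swp.
- by exists x, u0, u; split=> // x' u0' u' fx'; rewrite -eqv (weak _ _ _ _ _ _ fx' fy).
- move=> x' u0' u' [fx' opt].
  have e : primal_obj q u0' = primal_obj q u0.
    by apply/eqP; rewrite eq_le (opt _ _ _ fx) -eqv (weak _ _ _ _ _ _ fx' fy).
  by split=> // s hs ind; rewrite -e; apply: primal_security fx' hs ind.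
- by exists y, w0, w; split=> // y' w0' w' fy'; rewrite eqv (weak _ _ _ _ _ _ fx fy').
- move=> y' w0' w' [fy' opt].
  have e : dual_obj p w0' = primal_obj q u0.
    by apply/eqP; rewrite eq_le -{1}eqv (opt _ _ _ fy) (weak _ _ _ _ _ _ fx fy').
  by split=> // t ht ind; rewrite -e; exact: (dual_security hp hq hA hB hT fy').
Qed.
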